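(* Let $N\ge 2$ be an integer. (i) For any even Dirichlet character $\chi$ modulo $N$ and any integer $n\ge 1$, $$L(2n,\chi)=\frac{\pi^{2n}}{2(2n-1)!\,N^{2n}}\sum_{i=1}^{n}a_{n,i}\,L_{\mathbb{Z}/N\mathbb{Z}}(i,\chi),$$ where $$a_{n,i}=2\sum_{l=1}^{i}(-1)^{n-l}\,t(n-l,n-i)\,\overline{A}(2n,l)\qquad(1\le i\le n).$$ (ii) For any odd Dirichlet character $\chi$ modulo $N$ and any integer $n\ge 1$, $$L(2n+1,\chi)=\frac{\pi^{2n+1}}{(2n)!\,N^{2n+1}}\sum_{i=1}^{n}b_{n,i}\,\widetilde{L}_{\mathbb{Z}/N\mathbb{Z}}(i,\chi),$$ where $$b_{n,i}=\sum_{l=1}^{i}(-1)^{n-l}\,u(n-l,n-i)\,\overline{A}(2n+1,l)=i\,a_{n,i}\qquad(1\le i\le n).$$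
   Context: A Dirichlet character modulo $N$ is a homomorphism $\chi:(\mathbb{Z}/N\mathbb{Z})^\times\to\mathbb{C}^\times$, extended to $\mathbb{Z}$ by $\chi(m)=0$ if $\gcd(m,N)>1$; it need not be primitive. It is even if $\chi(-1)=1$ and odd if $\chi(-1)=-1$. $L(s,\chi)=\sum_{k=1}^\infty\chi(k)k^{-s}$. Set $$L_{\mathbb{Z}/N\mathbb{Z}}(s,\chi)=\sum_{m=1}^{N-1}\frac{\chi(m)}{\sin^{2s}(m\pi/N)},\qquad \widetilde{L}_{\mathbb{Z}/N\mathbb{Z}}(s,\chi)=\sum_{m=1}^{N-1}\frac{\chi(m)\cot(m\pi/N)}{\sin^{2s}(m\pi/N)}.$$ For integers $0\le i\le k$, $u(k,i)=(-1)^{k-i}2^{2i}\binom{k+i}{k-i}$; for $0\le i\le k$ with $k\ge 1$, $t(k,i)=(-1)^{k-i}2^{2i}\frac{k}{k+i}\binom{k+i}{k-i}$, and by convention $t(0,0)=\frac12$. A circular $n$-permutation is an arrangement $\sigma=(\sigma(1),\dots,\sigma(n))$ of $\{1,\dots,n\}$ on a circle, considered up to rotation; with $\sigma(n+1)=\sigma(1)$, a descent of $\sigma$ is an entry $\sigma(i)$, $1\le i\le n$, with $\sigma(i)>\sigma(i+1)$. $\overline{A}(n,l)$ denotes the number of circular $n$-permutations with exactly $l$ descents. *)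

(* Defs.v *)
From mathcomp Require Import all_boot all_order all_algebra all_fingroup.
From mathcomp Require Import complex.
From mathcomp Require Import all_classical all_reals all_analysis.

Set Implicit Arguments.
Unset Strict Implicit.
Unset Printing Implicit Defensive.

Import Order.TTheory GRing.Theory Num.Theory.
Import numFieldNormedType.Exports.

Local Open Scope ring_scope.
Local Open Scope complex_scope.

(* A homomorphism (Z/NZ)^* -> C^*, with C = R[i].  ['Z_N] is Z/NZ only for
   [1 < N]. *)
Record dirichletChar (R : realType) (N : nat) := DirichletChar {
  dchar_unit :> {unit 'Z_N} -> R[i];
  dchar_neq0 : forall u, dchar_unit u != 0;
  dchar_mul : forall u v, dchar_unit (u * v)%g = dchar_unit u * dchar_unit v
}.

(* Extension to Z.  [m%:~R] is the class of [m] in ['Z_N]; when [1 < N] and [m]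
   is coprime to [N] it is a unit, so the default value of [insubd] is unused. *)
Definition dchar (R : realType) (N : nat) (chi : dirichletChar R N)
    (m : int) : R[i] :=
  if coprimez m N then chi (insubd (1%g : {unit 'Z_N}) (m%:~R : 'Z_N)) else 0.

Definition dchar_even (R : realType) (N : nat) (chi : dirichletChar R N) :=
  dchar chi (-1) = 1.

Definition dchar_odd (R : realType) (N : nat) (chi : dirichletChar R N) :=
  dchar chi (-1) = -1.

(* Partial sums of [\sum_(k >= 1) f k / k ^ s], for natural exponents [s].  They
   are over an abstract numFieldType because the topology is canonical there;
   for R[i] it is the one of the complex modulus. *)
Definition Lpartial (K : numFieldType) (f : int -> K) (s : nat) : nat -> K :=
  series (fun k : nat => f (k.+1)%:Z / (k.+1)%:R ^+ s).

Definition Lseries (K : numFieldType) (f : int -> K) (s : nat) : K :=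
  limn (Lpartial f s).

Definition cot (R : realType) (x : R) : R := cos x / sin x.

(* [cycleL s chi] is L_{Z/NZ}(s, chi) and [cycleLtilde s chi] is
   \widetilde{L}_{Z/NZ}(s, chi), for natural [s]. *)
Definition cycleL (R : realType) (N : nat) (s : nat)
    (chi : dirichletChar R N) : R[i] :=
  \sum_(1 <= m < N)
    dchar chi m / (sin (m%:R * pi / N%:R : R) ^+ (2 * s))%:C.

Definition cycleLtilde (R : realType) (N : nat) (s : nat)
    (chi : dirichletChar R N) : R[i] :=
  \sum_(1 <= m < N)
    dchar chi m * (cot (m%:R * pi / N%:R : R))%:C
      / (sin (m%:R * pi / N%:R : R) ^+ (2 * s))%:C.

(* Positions and entries are numbered from 0, so [sigma : 'S_n] stands for the
   arrangement (sigma 0, ..., sigma n.-1), and [ordS] is the next position on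
   the circle. *)
Definition rotp (n : nat) : 'S_n := perm (@ordS_inj n).

(* [(rotp n ^+ k * sigma) i = sigma (i + k mod n)], so a right coset of
   [<[rotp n]>] is an arrangement up to rotation. *)
Definition circ_perms (n : nat) : {set {set 'S_n}} :=
  rcosets <[rotp n]>%g [set: 'S_n].

Definition cdes (n : nat) (sigma : 'S_n) : nat :=
  #|[pred i : 'I_n | (sigma (ordS i) < sigma i)%N]|.

Lemma cdes_circ (n : nat) (C : {set 'S_n}) (sigma tau : 'S_n) :
  C \in circ_perms n -> sigma \in C -> tau \in C -> cdes sigma = cdes tau.
Proof.
have cdesM (rho : 'S_n) : cdes (rotp n * rho)%g = cdes rho.
  rewrite /cdes -(fintype.card_image (@ordS_inj n)); apply: eq_card => i.
  rewrite -(ord_predK i) fintype.mem_image; last exact: ordS_inj.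
  by rewrite !inE !permM !permE.
have cdesX k (rho : 'S_n) : cdes (rotp n ^+ k * rho)%g = cdes rho.
  by elim: k => [|k IHk]; rewrite ?mul1g // expgS -mulgA cdesM.
case/rcosetsP => rho _ ->.
move=> /rcosetP[_ /cycleP[j ->] ->] /rcosetP[_ /cycleP[k ->] ->].
by rewrite !cdesX.
Qed.

(* [\overline{A}(n, l)]; by [cdes_circ] the choice of [sigma] in [C] is
   immaterial. *)
Definition circEulerian (n l : nat) : nat :=
  #|[pred C in circ_perms n | [exists sigma in C, cdes sigma == l]]|.

(* In the four definitions below the truncated subtractions are exact in the
   ranges of interest, i <= k and 1 <= i <= n. *)

Definition u_coef (k i : nat) : rat :=
  (-1) ^+ (k - i) * 2 ^+ (2 * i) * 'C(k + i, k - i)%:R.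

Definition t_coef (k i : nat) : rat :=
  if k == 0%N then 1 / 2
  else (-1) ^+ (k - i) * 2 ^+ (2 * i) * (k%:R / (k + i)%:R)
         * 'C(k + i, k - i)%:R.

Definition a_coef (n i : nat) : rat :=
  2 * \sum_(1 <= l < i.+1)
        (-1) ^+ (n - l) * t_coef (n - l) (n - i) * (circEulerian (2 * n) l)%:R.

Definition b_coef (n i : nat) : rat :=
  \sum_(1 <= l < i.+1)
    (-1) ^+ (n - l) * u_coef (n - l) (n - i) * (circEulerian (2 * n + 1) l)%:R.

(* Main.v *)
Require Import Defs.
From mathcomp Require Import all_boot all_order all_algebra all_fingroup.
From mathcomp Require Import complex.
From mathcomp Require Import all_classical all_reals all_analysis.
From mathcomp Require Import ring lra zify.

(** Let P_s be the polynomial such that P_s(cot t) is (-1)^(s-1) times the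
    (s-1)-th derivative of cot at t.  By the parity of chi, 2 N^s times the partial
    sum of L(s, chi) up to N 2^r is
    sum_(0 < m < N) chi(m) sum_(-2^r <= j < 2^r) (m/N + j)^(-s),
    so everything reduces to the limit pi^s/(s-1)! P_s(cot(pi x)) of the inner sum
    at x = m/N.  No partial fraction expansion of cot is needed for this: iterating
    cot t + cot(t + pi/2) = 2 cot(2t), differentiated s-1 times, writes
    2^(rs) P_s(cot(pi x)) as the sum of P_s(cot(pi y)) over the 2^r points
    y = (x + j)/2^r of ]0, 1[, where P_s(cot(pi y)) may be replaced by its principal
    parts at 0 and 1 with an error which is negligible after division by 2^(rs).

    It remains to expand P_s in powers of 1 + cot^2 = 1/sin^2.  The equation
    P_(s+1) = (1 + X^2) P_s' gives a recurrence for the coefficients, and a_(n,i),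
    b_(n,i) satisfy the same one: up to the factor (-4)^(n-i) they are sums of
    circular Eulerian numbers with binomial weights, to which one applies the
    recurrence for circular Eulerian numbers (insertion of a new maximum into a
    circular arrangement) and Pascal's rule. *)

Set Implicit Arguments.
Unset Strict Implicit.
Unset Printing Implicit Defensive.

Import Order.TTheory GRing.Theory Num.Theory.
Import numFieldNormedType.Exports.

Local Open Scope ring_scope.
Local Open Scope complex_scope.

(** * Circular Eulerian numbers *)

Lemma rotpX (n k : nat) (i : 'I_n) : (rotp n ^+ k)%g i = ((i + k) %% n)%N :> nat.
Proof.
elim: k => [|k IHk]; first by rewrite perm1 addn0 modn_small.
by rewrite expgSr permM permE /= IHk -addn1 modnDml addn1 addnS.
Qed.

Lemma order_rotp (n : nat) : (0 < n)%N -> #[rotp n]%g = n.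
Proof.
move=> n_gt0; apply/eqP; rewrite eqn_dvd cyclic.order_dvdn; apply/andP; split.
  by apply/eqP/permP=> i; apply: val_inj; rewrite /= rotpX perm1 modnDr modn_small.
have := rotpX #[rotp n]%g (Ordinal n_gt0).
by rewrite expg_order perm1 /= => /esym; rewrite add0n => /eqP.
Qed.

Lemma cdes_rotpM (n : nat) (s : 'S_n) : cdes (rotp n * s)%g = cdes s.
Proof.
case: n s => [|n] s; first by rewrite /cdes !eq_card0 // => -[].
apply: (@cdes_circ _ (<[rotp n.+1]> :* s)%g).
- by apply/rcosetsP; exists s; rewrite ?inE.
- by rewrite mem_rcoset mulgK cycle_id.
- exact: rcoset_refl.
Qed.

(** The rotation has order n, so each circular arrangement is a coset of exactly n permutations, and
    [cdes] is constant on it. *)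
Lemma card_cdes (n l : nat) : (0 < n)%N ->
  #|[set s : 'S_n | cdes s == l]| = (circEulerian n l * n)%N.
Proof.
move=> n_gt0; pose P := [set C in circ_perms n | [exists s in C, cdes s == l]].
have partG : finset.partition (circ_perms n) [set: 'S_n].
  by apply: rcosets_partition; apply: finset.subsetT.
have -> : circEulerian n l = #|P| by rewrite cardsE.
apply: card_uniform_partition => [C|].
  rewrite inE => /andP[/rcosetsP[s _ ->] _].
  by rewrite card_rcoset -orderE order_rotp.
case/and3P: partG => /eqP covG trivG n0; apply/and3P; split; last 1 first.
- by apply: contra n0; rewrite inE => /andP[].
- apply/eqP/setP=> s; rewrite inE; apply/bigcupP/idP.
    case=> C; rewrite inE => /andP[CG /exists_inP[t tC /eqP <-]] sC.
    by rewrite (cdes_circ CG sC tC).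
  move=> sl; exists (<[rotp n]> :* s)%g; last exact: rcoset_refl.
  rewrite inE; apply/andP; split; first by apply/rcosetsP; exists s; rewrite ?inE.
  by apply/exists_inP; exists s; rewrite ?rcoset_refl.
- by apply: trivIsetS trivG; apply/fintype.subsetP=> C; rewrite inE => /andP[].
Qed.

(** Prescribing the position of the maximum selects one representative of each circular arrangement.
    Rotations show that the count does not depend on the position, and the counts over all n+1
    positions add up to the one in [card_cdes]. *)
Lemma card_cdes_max (n l : nat) (i : 'I_n.+1) :
  #|[set s : 'S_n.+1 | (cdes s == l) && (s i == ord_max)]| = circEulerian n.+1 l.
Proof.
pose D i := #|[set s : 'S_n.+1 | (cdes s == l) && (s i == ord_max)]|.
have Drot j : D (ordS j) = D j.
  rewrite /D -(card_imset _ (mulgI (rotp n.+1))); apply: eq_card => s.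
  rewrite inE; apply/imsetP/idP.
    case=> t; rewrite inE => /andP[tl tj] ->.
    by rewrite cdes_rotpM tl permM permE.
  move=> /andP[sl sj]; exists ((rotp n.+1)^-1 * s)%g; last by rewrite mulKVg.
  rewrite inE -cdes_rotpM mulKVg sl permM /=.
  suff -> : (rotp n.+1)^-1%g (ordS j) = j by [].
  by apply: (@perm_inj _ (rotp n.+1)); rewrite permKV permE.
have D0 j : D j = D ord0.
  case: j => j; elim: j => [|j IHj] jn; first by congr D; apply: val_inj.
  rewrite -(IHj (ltnW jn)) -[RHS]Drot; congr D; apply: val_inj.
  by rewrite /= modn_small.
rewrite -/(D i) D0; apply/eqP.
rewrite -(eqn_pmul2r (ltn0Sn n)) -card_cdes //.
transitivity (\sum_(j < n.+1) D j == #|[set s : 'S_n.+1 | cdes s == l]|)%N.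
  by rewrite (eq_bigr (fun=> D ord0)) ?sum_nat_const ?card_ord 1?mulnC.
apply/eqP; rewrite -sum1dep_card.
rewrite (partition_big (fun s : 'S_n.+1 => s^-1%g ord_max) xpredT) //=.
apply: eq_bigr => j _; rewrite /D -sum1dep_card; apply: eq_bigl => s.
by congr (_ && _); apply/eqP/eqP => [<-|<-]; rewrite ?permK ?permKV.
Qed.

(** A position inserted right after [i] only changes the successor of [i], so all other gaps survive
    the insertion. *)
Lemma ordS_lift (m : nat) (i k : 'I_m.+1) : k != i ->
  ordS (lift (lift ord0 i) k) = lift (lift ord0 i) (ordS k).
Proof.
move=> ki; apply: val_inj; rewrite /= /bump /=.
have {ki} : (k : nat) != i by [].
case: i k => i im [k km] /= ki.
have [ik|ik] := ltnP i k; last first.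
  have ki' : (k < i)%N by lia.
  by rewrite !modn_small; lia.
rewrite leq_eqVlt in km; case/orP: km => [/eqP km|km]; last first.
  by rewrite !modn_small; lia.
have -> : k = m by lia.
by rewrite add1n !modnn.
Qed.

(* Inserting a new maximum in the gap of a circular arrangement that follows
   position [i] creates a descent unless this gap already is one. *)
Lemma cdes_lift_perm (m : nat) (i : 'I_m.+1) (s : 'S_m.+1) :
  (cdes (lift_perm (lift ord0 i) ord_max s) + (s (ordS i) < s i))%N
    = (cdes s).+1.
Proof.
set h := lift ord0 i; set t := lift_perm _ _ _.
have cdesE (p : nat) (r : 'S_p) : cdes r = (\sum_(j < p) (r (ordS j) < r j))%N.
  rewrite /cdes -sum1_card big_mkcond.
  by apply: eq_bigr => j _; rewrite inE; case: ltnP.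
have tl k : t (lift h k) = s k :> nat.
  by rewrite /t lift_perm_lift /= /bump leqNgt ltn_ord.
have th : t h = ord_max by rewrite /t lift_perm_id.
have Shi : ordS (lift h i) = h.
  by apply: val_inj; rewrite /= /bump /= /bump /= add1n ltnn add0n modn_small // ltnS.
rewrite !cdesE (bigD1_ord h) //= th.
have -> : (t (ordS h) < m.+1)%N.
  rewrite ltn_neqAle -ltnS ltn_ord andbT; apply/eqP => e.
  have /perm_inj : t (ordS h) = t h by apply: val_inj; rewrite th.
  move=> /(congr1 val) /=; rewrite /bump /= add1n.
  have [iE|iN] := eqVneq (i : nat) m; first by rewrite iE modnn.
  by rewrite modn_small; have := ltn_ord i; lia.
rewrite [in LHS](bigD1 i) //= Shi th tl /=.
have -> : (m.+1 < s i)%N = false by rewrite ltnNge ltnW.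
rewrite [in RHS](bigD1 i) //= add0n -addnA add1n addnC; congr _.+1.
congr (_ + _)%N; apply: eq_bigr => k ki.
by rewrite ordS_lift // !tl.
Qed.

Lemma lift_perm_inj (m : nat) (i j : 'I_m.+1) : injective (@lift_perm m i j).
Proof.
move=> s t e; apply/permP=> k; apply: (@lift_inj _ j).
by rewrite -!(lift_perm_lift i) e.
Qed.

Lemma lift_perm_surj (m : nat) (i : 'I_m.+1) (j : 'I_m.+1) (t : 'S_m.+1) :
  t i = j -> exists s, t = lift_perm i j s.
Proof.
move=> tij.
have tl k : j != t (lift i k) by rewrite -tij (inj_eq perm_inj) neq_lift.
pose f k := odflt k (unlift j (t (lift i k))).
have fE k : lift j (f k) = t (lift i k).
  by rewrite /f; have [u -> ->] := unlift_some (tl k).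
have f_inj : injective f.
  by move=> k k' e; apply: (@lift_inj _ i); apply: (@perm_inj _ t); rewrite -!fE e.
exists (perm f_inj); apply/permP=> k.
have [<-|] := eqVneq i k; first by rewrite lift_perm_id.
by case/unlift_some => k' -> _; rewrite lift_perm_lift permE fE.
Qed.

Lemma circEulerian1 (l : nat) : circEulerian 1 l = (l == 0)%N.
Proof.
have := @card_cdes 1 l isT; rewrite muln1 => <-.
have cdes0 (s : 'S_1) : cdes s = 0%N.
  by rewrite /cdes eq_card0 // => i; rewrite inE !ord1 ltnn.
have [->|l0] := posnP l.
  rewrite -[RHS]/(1`!)%N -card_Sn -cardsT; apply: eq_card => s.
  by rewrite !inE cdes0.
rewrite (_ : [set _ | _] = finset.set0) ?cards0; first lia.
by apply/setP=> s; rewrite !inE cdes0; lia.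
Qed.

(** For each gap [i], insertion of the maximum there is a bijection onto the permutations whose
    maximum sits right after [i]; by [card_cdes_max] these represent every circular arrangement
    once. Summation over the m+1 gaps gives the left factor. *)
Lemma circEulerian_insert (m l : nat) :
  (m.+1 * circEulerian m.+2 l)%N =
  (\sum_(s : 'S_m.+1) \sum_(i < m.+1) ((cdes s).+1 == l + (s (ordS i) < s i)))%N.
Proof.
rewrite exchange_big /= (eq_bigr (fun=> circEulerian m.+2 l)) => [|i _].
  by rewrite sum_nat_const card_ord.
rewrite -(card_cdes_max l (lift ord0 i)).
rewrite -[LHS]big_mkcond sum1dep_card.
rewrite -(card_imset _ (@lift_perm_inj _ (lift ord0 i) ord_max)).
apply: eq_card => t; rewrite inE; apply/imsetP/andP.
  case=> s; rewrite inE -(cdes_lift_perm i s) eqn_add2r => sl ->.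
  by rewrite lift_perm_id.
case=> tl /eqP /lift_perm_surj[s ts]; exists s => //.
by rewrite inE -(cdes_lift_perm i s) eqn_add2r -ts.
Qed.

(** The descent gaps preserve the number of descents and the others raise it by one. In the second
    case [s] has l-1 descents, which leaves m+1-(l-1) other gaps. *)
Lemma sum_cdes_gap (m l : nat) (s : 'S_m.+1) :
  (\sum_(i < m.+1) ((cdes s).+1 == l + (s (ordS i) < s i)))%N =
  (l * (cdes s == l) + (m.+1 - l.-1) * ((cdes s).+1 == l))%N.
Proof.
rewrite (bigID (fun i => s (ordS i) < s i)%N) /=.
congr addn.
  rewrite (eq_bigr (fun=> nat_of_bool (cdes s == l))) => [|i ->]; last first.
    by rewrite addn1 eqSS.
  rewrite sum_nat_const; rewrite -/(cdes s); case: eqP => [->|] //.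
  by rewrite !muln0.
rewrite (eq_bigr (fun=> nat_of_bool ((cdes s).+1 == l))) => [|i /negbTE ->]; last first.
  by rewrite addn0.
rewrite sum_nat_const; case: eqP => [<-|]; last by rewrite !muln0.
have := cardC [pred i | (s (ordS i) < s i)%N].
rewrite card_ord -[X in (X + _)%N]/(cdes s) !muln1 /= => h.
apply/eqP; rewrite -(eqn_add2l (cdes s)) h subnKC //.
by rewrite (leq_trans (max_card _)) // card_ord.
Qed.

Lemma circEulerian_rec (m l : nat) :
  circEulerian m.+2 l = (l * circEulerian m.+1 l
     + (0 < l) * (m.+1 - l.-1) * circEulerian m.+1 l.-1)%N.
Proof.
apply/eqP; rewrite -(eqn_pmul2l (ltn0Sn m)) circEulerian_insert; apply/eqP.
rewrite (eq_bigr _ (fun s _ => sum_cdes_gap l s)) big_split /= -!big_distrr /=.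
have cE k : (\sum_(s : 'S_m.+1) (cdes s == k) = m.+1 * circEulerian m.+1 k)%N.
  rewrite mulnC -card_cdes // -sum1dep_card [RHS]big_mkcond.
  by apply: eq_bigr => s _; case: eqP.
rewrite cE; case: l => [|l] /=; last by rewrite cE; ring.
by rewrite big1 //; ring.
Qed.

Lemma circEulerian0r (m : nat) : circEulerian m.+2 0 = 0%N.
Proof. by rewrite circEulerian_rec. Qed.

Lemma circEulerian_ge (m l : nat) : (m < l)%N -> circEulerian m.+1 l = 0%N.
Proof.
elim: m l => [|m IHm] [|l] // ml; first by rewrite circEulerian1.
by rewrite circEulerian_rec /= !IHm ?muln0 //; lia.
Qed.

(** The reflection of l exchanges the two terms of [circEulerian_rec]. The size starts at 2 because
    the symmetry fails for a single entry. *)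
Lemma circEulerian_sym (m l : nat) : (l <= m.+2)%N ->
  circEulerian m.+2 l = circEulerian m.+2 (m.+2 - l).
Proof.
elim: m l => [|m IHm] l lm.
  by case: l lm => [|[|[|l]]] // _; rewrite !circEulerian_rec !circEulerian1.
have [->|l0] := posnP l; first by rewrite circEulerian0r circEulerian_ge.
move: lm; rewrite leq_eqVlt => /orP[/eqP ->|lm].
  by rewrite subnn circEulerian0r circEulerian_ge.
rewrite 2!(circEulerian_rec m.+1) l0 subn_gt0 lm !mul1n.
have -> : circEulerian m.+2 (m.+3 - l).-1 = circEulerian m.+2 l.
  by rewrite (IHm l) //; congr circEulerian; lia.
have -> : circEulerian m.+2 (m.+3 - l) = circEulerian m.+2 l.-1.
  by rewrite (IHm l.-1); [congr circEulerian; lia | lia].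
have -> : (m.+2 - (m.+3 - l).-1 = l)%N by lia.
by rewrite addnC; congr (_ * _ + _)%N; lia.
Qed.

(** * The coefficients a and b *)

(** Summation by parts: the recurrence is moved from the Eulerian numbers to the weights [G]. Since
    the sum stops at n+1, the last term has no partner and stays as a boundary term. *)
Lemma sum_circEulerian_rec (m n : nat) (G : nat -> nat) :
  (\sum_(1 <= l < n.+2) G l * circEulerian m.+3 l =
   \sum_(1 <= l < n.+1) (l * G l + (m.+2 - l) * G l.+1) * circEulerian m.+2 l
   + n.+1 * G n.+1 * circEulerian m.+2 n.+1)%N.
Proof.
rewrite (eq_big_nat _ _ (F2 := fun l => l * G l * circEulerian m.+2 l
   + (m.+3 - l) * G l * circEulerian m.+2 l.-1)%N); last first.
  by move=> [|l] // _; rewrite circEulerian_rec /= subSS; ring.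
rewrite big_split /= big_nat_recr //=.
rewrite [X in (_ + X)%N]big_add1 [X in (_ + X)%N]big_ltn //= circEulerian0r muln0 add0n.
rewrite -addnA [X in (_ + X)%N]addnC addnA; congr addn.
rewrite [X in (_ + X)%N](_ : _ = \sum_(1 <= l < n.+1)
  (m.+2 - l) * G l.+1 * circEulerian m.+2 l)%N; last by [].
by rewrite -big_split; apply: eq_bigr => l _ /=; rewrite mulnDl.
Qed.

(* [4 ^ j] times these are, up to sign, the coefficients of [x ^ (2 * j)] in the
   Chebyshev polynomials [U_(2k)] and, for [0 < k], [2 * T_(2k)]; for [k = 0] the
   latter is halved, as in the convention [t(0,0) = 1/2]. *)
Definition chebU (k j : nat) : nat := 'C(k + j, 2 * j).
Definition chebT (k j : nat) : nat := (chebU k j + (0 < k) * chebU k.-1 j)%N.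

(** Signs and powers of 4 are stripped from [a_coef] and [b_coef], and the range of l is extended
    from i to n. The added terms vanish by [chebU_small] and [chebT_small], and a range independent
    of i allows comparison term by term. *)
Definition a_nat (n i : nat) : nat :=
  \sum_(1 <= l < n.+1) (chebT (n - l) (n - i) * circEulerian (2 * n) l)%N.
Definition b_nat (n i : nat) : nat :=
  \sum_(1 <= l < n.+1) (chebU (n - l) (n - i) * circEulerian (2 * n + 1) l)%N.

Lemma chebU_small (k j : nat) : (k < j)%N -> chebU k j = 0%N.
Proof. by move=> kj; rewrite /chebU bin_small //; lia. Qed.

Lemma chebT_small (k j : nat) : (k < j)%N -> chebT k j = 0%N.
Proof. by move=> kj; rewrite /chebT !chebU_small ?muln0 //; lia. Qed.

(** This is (k+j) C(k-1+j, 2j) = (k-j) C(k+j, 2j), written without subtraction. *)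
Lemma chebU_pred (k j : nat) : (0 < k)%N ->
  ((k + j) * chebU k.-1 j + j * chebU k j = k * chebU k j)%N.
Proof.
case: k => // k _ /=; rewrite /chebU addSn.
have := mul_bin_left (k + j).+1 (2 * j); have := mul_bin_diag (k + j).+1 (2 * j).
have [kj|kj] := leqP j k.+1.
  rewrite (_ : ((k + j).+1 - 2 * j = k.+1 - j)%N); last lia.
  move=> h1 h2.
  have : ((k + j).+1 * 'C(k + j, 2 * j) = (k.+1 - j) * 'C((k + j).+1, 2 * j))%N.
    by rewrite h1 h2.
  by move=> ->; rewrite -mulnDl subnK.
by move=> _ _; rewrite !bin_small //; lia.
Qed.

(** The recurrence lowers the Eulerian numbers of size 2n+1 to size 2n; the weights then agree term
    by term by [chebU_pred]. *)
Lemma b_nat_a_nat (n i : nat) : (0 < n)%N -> (i <= n)%N ->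
  b_nat n i = (i * a_nat n i)%N.
Proof.
case: n => // n _ lein; rewrite /b_nat /a_nat.
have -> : (2 * n.+1 + 1 = (2 * n).+3)%N by lia.
have -> : (2 * n.+1 = (2 * n).+2)%N by lia.
rewrite sum_circEulerian_rec big_distrr /= [in RHS]big_nat_recr //= subnn.
(* Boundary term: here k = 0, and [chebU 0 (n.+1 - i)] vanishes unless i = n+1. *)
congr addn; last first.
  rewrite !mulnA /chebT /= mul0n addn0; congr muln.
  have [->|lt] := eqVneq i n.+1; first by [].
  by rewrite chebU_small ?muln0 //; lia.
apply: eq_big_nat => l /andP[l0 ln]; rewrite mulnA; congr muln.
have -> : (n.+1 - l.+1 = (n.+1 - l).-1)%N by lia.
have k0 : (0 < n.+1 - l)%N by lia.
have := chebU_pred (n.+1 - i) k0.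
rewrite /chebT k0 mul1n.
have -> : ((2 * n).+2 - l = n.+1 + (n.+1 - l))%N by lia.
have : (l + (n.+1 - l) = n.+1)%N by lia.
have : (i + (n.+1 - i) = n.+1)%N by lia.
move: (n.+1 - l)%N (n.+1 - i)%N {k0} => k j.
move: (chebU k _) (chebU k.-1 _) => u v ij lk huv.
have := congr1 (addn (k * v)) huv; move: {huv} ij lk => <-.
by move: n {ln lein} => _ lk; nia.
Qed.

(** Coefficient form of U_(2k+2) + U_(2k-2) = (4x^2 - 2) U_(2k), obtained from Pascal's rule applied
    twice. *)
Lemma chebU_pascal (k j : nat) :
  (chebU k.+1 j.+1 + (0 < k) * chebU k.-1 j.+1 =
   2 * chebU k j.+1 + chebU k j)%N.
Proof.
rewrite /chebU; case: k => [|k].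
  by case: j => [|j] //; rewrite !bin_small //; lia.
rewrite mul1n /= !addSn !addnS (_ : (2 * j.+1 = (2 * j).+2)%N); last lia.
by rewrite !binS; lia.
Qed.

(** Size 2n+2 is lowered to size 2n+1, and the boundary term vanishes for i <= n. The equality of
    weights combines [chebU_pascal] with [chebU_pred] at k and at k+1. *)
Lemma a_nat_rec (n i : nat) : (0 < i <= n)%N ->
  a_nat n.+1 i = (2 * (2 * i).-1 * b_nat n i.-1 + i * b_nat n i)%N.
Proof.
case/andP=> i0 lein; have n0 : (0 < n)%N by lia.
rewrite /a_nat /b_nat.
have [m mE] : exists m, (2 * n.+1 = m.+3 /\ 2 * n + 1 = m.+2)%N.
  by exists (2 * n).-1; lia.
have [-> ->] := mE.
rewrite sum_circEulerian_rec subnn chebT_small ?muln0 ?addn0; last lia.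
rewrite !big_distrr -big_split /=.
apply: eq_big_nat => l /andP[l0 ln].
rewrite !mulnA -mulnDl; congr muln.
have -> : (n - i.-1 = (n - i).+1)%N by lia.
have -> : (n.+1 - i = (n - i).+1)%N by lia.
have -> : (n.+1 - l = (n - l).+1)%N by lia.
rewrite subSS.
have -> : (m.+2 - l = n.+1 + (n - l))%N by lia.
have : (l + (n - l) = n)%N by lia.
have : (i + (n - i) = n)%N by lia.
move: (n - l)%N (n - i)%N => k j ij lk.
have pk : ((k + j.+1) * ((0 < k) * chebU k.-1 j.+1) + j.+1 * chebU k j.+1
            = k * chebU k j.+1)%N.
  have [k0|k0] := posnP k; last by rewrite mul1n chebU_pred.
  by rewrite k0 !chebU_small // !muln0.
move: (@chebU_pred k.+1 j.+1 isT) (chebU_pascal k j) pk.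
rewrite /chebT mul1n /=.
move: (chebU k.+1 _) (chebU k j.+1) (chebU k j) ((0 < k) * chebU k.-1 _)%N
  => u v w x h3 h1 h2.
(* With i + j = n = l + k, these are the products in which the identity becomes linear. *)
have := congr1 (muln i) h1.
have := congr1 (muln u) (etrans ij (esym lk)).
have := congr1 (muln v) (etrans ij (esym lk)).
have := congr1 (muln v) ij; have := congr1 (muln x) ij.
have -> : (2 * i).-1 = (2 * i - 1)%N by lia.
rewrite mulnBr mulnBl.
have := leq_mul i0 (leqnn v).
by nia.
Qed.

(** For i = n+1 the boundary term survives. It carries the Eulerian number of size 2n+1 with n+1
    descents, which the symmetry turns into the one with n descents. *)
Lemma a_nat_top (n : nat) : (0 < n)%N ->
  a_nat n.+1 n.+1 = (2 * (2 * n).+1 * b_nat n n)%N.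
Proof.
case: n => // n _; rewrite /a_nat /b_nat.
have -> : (2 * n.+2 = (2 * n).+4)%N by lia.
have -> : (2 * n.+1 + 1 = (2 * n).+3)%N by lia.
rewrite sum_circEulerian_rec !subnn.
rewrite [in RHS]big_distrr /= big_nat_recr // [in RHS]big_nat_recr //= subnn.
rewrite (circEulerian_sym (l := n.+2)); last by lia.
have -> : ((2 * n).+3 - n.+2 = n.+1)%N by lia.
have -> : (n.+2 - n.+1 = 1)%N by lia.
have U0 k : chebU k 0 = 1%N by rewrite /chebU muln0 bin0.
rewrite -addnA; congr addn; last first.
  by rewrite /chebT !U0 /= -mulnDl mulnA; congr muln; lia.
apply: eq_big_nat => l /andP[l0 ln]; rewrite mulnA; congr muln.
rewrite /chebT !U0 subSS !subn_gt0 ltnW // ln; lia.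
Qed.

Lemma a_nat11 : a_nat 1 1 = 1%N.
Proof. by rewrite /a_nat big_nat1 /chebT /chebU circEulerian_rec !circEulerian1. Qed.

Lemma sum_coef_trunc (n i : nat) (F G : nat -> rat) : (i <= n)%N ->
  (forall l, (0 < l <= i)%N -> F l = G l) ->
  (forall l, (i < l <= n)%N -> G l = 0) ->
  \sum_(1 <= l < i.+1) F l = \sum_(1 <= l < n.+1) G l.
Proof.
move=> lein FG G0; rewrite [RHS](big_cat_nat (n := i.+1)) //=.
rewrite [X in _ + X]big1_seq ?addr0 => [|l]; last first.
  by rewrite mem_index_iota => /andP[_ /andP[il ln]]; apply: G0; rewrite il.
by apply: eq_big_nat => l /FG.
Qed.

Lemma u_coefE (k i : nat) : (i <= k)%N ->
  u_coef k i = (-1) ^+ (k - i) * 4 ^+ i * (chebU k i)%:R.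
Proof.
move=> ik; rewrite /u_coef exprM; congr (_ * _ * _%:R).
by rewrite /chebU -bin_sub; [congr ('C(_, _)) |]; lia.
Qed.

Lemma t_coefE (k i : nat) : (i <= k)%N ->
  2 * t_coef k i = (-1) ^+ (k - i) * 4 ^+ i * (chebT k i)%:R.
Proof.
rewrite /t_coef; case: eqP => [-> /[!leqn0]/eqP ->|/eqP k0 ik].
  by rewrite (_ : chebT 0 0 = 1%N) //; field.
have -> : (2 : rat) ^+ (2 * i) = 4 ^+ i by rewrite exprM.
have ki0 : ((k + i)%:R : rat) != 0 by rewrite pnatr_eq0; lia.
have -> : 'C(k + i, k - i) = chebU k i.
  by rewrite /chebU -bin_sub; [congr ('C(_, _)) |]; lia.
have -> : ((chebT k i)%:R : rat) = 2 * (k%:R / (k + i)%:R) * (chebU k i)%:R.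
  (* By [chebU_pred] the two parts of [chebT] contribute (k+i) and (k-i) times [chebU k i]. *)
  have h : ((k + i)%:R * (chebT k i)%:R : rat) = 2 * k%:R * (chebU k i)%:R.
    rewrite -!natrM; congr _%:R.
    by have := @chebU_pred k i; rewrite /chebT lt0n k0 => /(_ isT); lia.
  by move: ki0 h; move: ((k + i)%:R : rat) => y y0 h; rewrite -[LHS](mulKf y0) h; field.
by ring.
Qed.

Lemma a_coefE (n i : nat) : (i <= n)%N ->
  a_coef n i = (-4) ^+ (n - i) * (a_nat n i)%:R.
Proof.
move=> lein; rewrite /a_coef /a_nat natr_sum !big_distrr /=.
apply: sum_coef_trunc => // l /andP[l0 li]; last by rewrite chebT_small ?mulr0 //; lia.
transitivity ((-1) ^+ (n - l) * (2 * t_coef (n - l) (n - i))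
                 * (circEulerian (2 * n) l)%:R); first by ring.
rewrite t_coefE; last lia.
rewrite natrM (_ : (-4) ^+ (n - i) = (-1) ^+ (n - i) * 4 ^+ (n - i) :> rat); last first.
  by rewrite -exprMn mulN1r.
have -> : ((-1) ^+ (n - i) : rat) = (-1) ^+ (n - l) * (-1) ^+ (n - l - (n - i)).
  rewrite -exprD -signr_odd -[RHS]signr_odd; congr (_ ^+ _); lia.
by ring.
Qed.

Lemma b_coefE (n i : nat) : (i <= n)%N ->
  b_coef n i = (-4) ^+ (n - i) * (b_nat n i)%:R.
Proof.
move=> lein; rewrite /b_coef /b_nat natr_sum !big_distrr /=.
apply: sum_coef_trunc => // l /andP[l0 li]; last by rewrite chebU_small ?mulr0 //; lia.
rewrite u_coefE; last lia.
rewrite natrM (_ : (-4) ^+ (n - i) = (-1) ^+ (n - i) * 4 ^+ (n - i) :> rat); last first.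
  by rewrite -exprMn mulN1r.
have -> : ((-1) ^+ (n - i) : rat) = (-1) ^+ (n - l) * (-1) ^+ (n - l - (n - i)).
  rewrite -exprD -signr_odd -[RHS]signr_odd; congr (_ ^+ _); lia.
by ring.
Qed.

Lemma b_coef_a_coef (n i : nat) : (0 < n)%N -> (i <= n)%N ->
  b_coef n i = i%:R * a_coef n i.
Proof.
by move=> n0 lein; rewrite b_coefE // a_coefE // b_nat_a_nat // natrM; ring.
Qed.

Lemma a_coef11 : a_coef 1 1 = 1.
Proof. by rewrite a_coefE // a_nat11 mulr1. Qed.

(** [b_nat] is eliminated from [a_nat_rec]; the result is the recurrence produced by two derivations
    in [cotD_csc]. At i = 1 the factor 2i - 2 removes [a_coef n 0]. *)
Lemma a_coef_rec (n i : nat) : (0 < i <= n)%N ->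
  a_coef n.+1 i = (2 * i - 2)%:R * (2 * i - 1)%:R * a_coef n i.-1
                    - 4 * i%:R ^+ 2 * a_coef n i.
Proof.
case: i => // i /andP[_ lein].
have lein1 : (i <= n)%N := ltnW lein.
have lein2 : (i < n.+1)%N by lia.
have n0 : (0 < n)%N by lia.
rewrite (a_coefE lein1) (a_coefE lein) (a_coefE lein2) a_nat_rec; last lia.
rewrite -[i.+1.-1]/i (b_nat_a_nat n0 lein1) (b_nat_a_nat n0 lein).
have -> : (n.+1 - i.+1 = (n - i.+1).+1)%N by lia.
have -> : (n - i = (n - i.+1).+1)%N by lia.
have -> : (2 * (2 * i.+1).-1 * (i * a_nat n i) =
           (2 * i.+1 - 2) * (2 * i.+1 - 1) * a_nat n i)%N by lia.
rewrite [X in _ * X%:R = _]addnC exprSr.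
move: ((-4) ^+ _) (2 * i.+1 - 2)%N (2 * i.+1 - 1)%N => c x y.
by rewrite natrD !natrM; ring.
Qed.

Lemma a_coef_top (n : nat) : (0 < n)%N ->
  a_coef n.+1 n.+1 = (2 * n)%:R * (2 * n).+1%:R * a_coef n n.
Proof.
move=> n0; rewrite !a_coefE // a_nat_top // b_nat_a_nat // !subnn !mul1r -!natrM.
by congr _%:R; lia.
Qed.

(** * Derivatives of the cotangent *)

(* [(cotD k).[cot t]] is [(-1) ^ k] times the [k]-th derivative of [cot] at [t]. *)
Definition cotD (R : nzRingType) (k : nat) : {poly R} :=
  iter k (fun p => (1 + 'X^2) * p^`()) 'X.

Lemma cotDS (R : nzRingType) (k : nat) :
  cotD R k.+1 = (1 + 'X^2) * (cotD R k)^`().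
Proof. by []. Qed.

Lemma deriv_sqD1 (R : comNzRingType) : (1 + 'X^2)^`() = 2%:R *: 'X :> {poly R}.
Proof. by rewrite derivD derivXn -polyC1 derivC add0r scaler_nat. Qed.

Lemma deriv_sqD1_exp (R : comNzRingType) (i : nat) :
  (1 + 'X^2) * ((1 + 'X^2) ^+ i)^`() = (2 * i)%:R *: ('X * (1 + 'X^2) ^+ i) :> {poly R}.
Proof.
case: i => [|i]; first by rewrite expr0 -polyC1 derivC mulr0 muln0 scale0r.
rewrite deriv_exp deriv_sqD1 /= -!mul_polyC !polyCMn polyC1 natrM.
by rewrite -[in LHS]mulr_natl [_ ^+ i.+1]exprS; move: (_ ^+ i) => p; ring.
Qed.

(** With [deriv_sqD1_exp], this shows that p -> (1 + X^2) p' exchanges the span of the powers of 1 +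
    X^2 with X times that span. Here X^2 is rewritten as (1 + X^2) - 1. *)
Lemma deriv_X_sqD1_exp (R : comNzRingType) (i : nat) :
  (1 + 'X^2) * ('X * (1 + 'X^2) ^+ i)^`() =
  (2 * i + 1)%:R *: (1 + 'X^2) ^+ i.+1 - (2 * i)%:R *: (1 + 'X^2) ^+ i :> {poly R}.
Proof.
rewrite derivM derivX mul1r mulrDr mulrCA deriv_sqD1_exp -!mul_polyC !polyCMn polyC1.
rewrite (natrD _ (2 * i) 1) (natrM _ 2 i) [_ ^+ i.+1]exprS.
by move: (_ ^+ i) => p; ring.
Qed.

Lemma cotD_csc (R : realType) (n : nat) :
  cotD R (2 * n).+1 =
    \sum_(1 <= i < n.+2) ratr (a_coef n.+1 i) *: (1 + 'X^2) ^+ i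
  /\ cotD R (2 * n).+2 =
    \sum_(1 <= i < n.+2) (2 * i%:R * ratr (a_coef n.+1 i)) *: ('X * (1 + 'X^2) ^+ i).
Proof.
have even_step k : cotD R (2 * k).+1 =
    \sum_(1 <= i < k.+2) ratr (a_coef k.+1 i) *: (1 + 'X^2) ^+ i ->
  cotD R (2 * k).+2 =
    \sum_(1 <= i < k.+2) (2 * i%:R * ratr (a_coef k.+1 i)) *: ('X * (1 + 'X^2) ^+ i).
  move=> ck; rewrite cotDS ck raddf_sum big_distrr /=; apply: eq_bigr => i _.
  by rewrite derivZ -scalerAr deriv_sqD1_exp scalerA natrM mulrC.
suff odd_sum k : cotD R (2 * k).+1 =
    \sum_(1 <= i < k.+2) ratr (a_coef k.+1 i) *: (1 + 'X^2) ^+ i.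
  by split; [|apply: even_step]; apply: odd_sum.
elim: k => [|k IHk].
  by rewrite big_nat1 a_coef11 rmorph1 scale1r expr1 muln0 cotDS derivX mulr1.
rewrite (_ : (2 * k.+1).+1 = (2 * k).+3)%N; last lia.
rewrite cotDS (even_step _ IHk) raddf_sum big_distrr /=.
rewrite (eq_bigr (fun i => ((2 * i)%:R * (2 * i + 1)%:R * ratr (a_coef k.+1 i)) *:
    (1 + 'X^2) ^+ i.+1 - (4 * i%:R ^+ 2 * ratr (a_coef k.+1 i)) *: (1 + 'X^2) ^+ i));
  last first.
  move=> i _; rewrite derivZ -scalerAr deriv_X_sqD1_exp scalerBr !scalerA.
  by congr (_ *: _ - _ *: _); rewrite ?natrM; ring.
rewrite sumrB [RHS]big_nat_recr //= a_coef_top //.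
rewrite big_nat_recr //= (addrAC _ _ (- _)); congr (_ + _); last first.
  by rewrite !rmorphM /= !ratr_nat addn1.
(* Index shift by one; [g 1] vanishes, so both sums may start at 1. *)
pose g i : {poly R} := ((2 * i - 2)%:R * (2 * i - 1)%:R * ratr (a_coef k.+1 i.-1)) *:
  (1 + 'X^2) ^+ i.
transitivity (\sum_(1 <= i < k.+2) g i -
   \sum_(1 <= i < k.+2) (4 * i%:R ^+ 2 * ratr (a_coef k.+1 i)) *: (1 + 'X^2) ^+ i).
  congr (_ - _); rewrite [RHS]big_ltn // {1}/g muln1 subnn !mul0r scale0r add0r.
  rewrite [RHS]big_add1; apply: eq_big_nat => i /andP[i0 _]; rewrite /g.
  by congr ((_%:R * _%:R * _) *: _); lia.
rewrite -sumrB; apply: eq_big_nat => i ik.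
rewrite [a_coef k.+2 i]a_coef_rec // /g -scalerBl; congr (_ *: _).
by rewrite rmorphB !rmorphM /= !ratr_nat.
Qed.

Lemma cotDN (R : comNzRingType) (k : nat) (c : R) :
  (cotD R k).[- c] = (-1) ^+ k.+1 * (cotD R k).[c].
Proof.
suff h : cotD R k \Po (- 'X) = (-1) ^+ k.+1 *: cotD R k.
  by rewrite -hornerZ -h horner_comp hornerN hornerX.
elim: k => [|k IHk]; first by rewrite comp_polyX expr1 scaleN1r.
rewrite cotDS comp_polyM comp_polyD rmorph1 /= comp_Xn_poly sqrrN.
have := congr1 (@deriv _) IHk; rewrite deriv_comp derivN derivX mulrN1 derivZ => /eqP.
by rewrite eqr_oppLR => /eqP ->; rewrite [in RHS]exprS mulN1r scaleNr mulrN -scalerAr.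
Qed.

(** There is no term of degree k. This gap of two degrees below the leading term is what makes the
    error in [cotD_near0] small enough. *)
Lemma cotD_lead (R : comNzRingType) (k : nat) : exists2 Q : {poly R},
  (size Q <= k)%N & cotD R k = (k`!)%:R *: 'X^(k.+1) + Q.
Proof.
elim: k => [|k [Q sQ cQ]]; first by exists 0; rewrite ?size_poly0 // addr0 scale1r.
exists ((k.+1`!)%:R *: 'X^k + (1 + 'X^2) * Q^`()); last first.
  rewrite cotDS cQ derivD derivZ derivXn /= factS natrM -!mul_polyC !polyCM.
  by rewrite -[_ *+ k.+1]mulr_natl polyCMn !exprS expr0; ring.
rewrite (leq_trans (size_polyD _ _)) // geq_max; apply/andP; split.
  by rewrite (leq_trans (size_scale_leq _ _)) // size_polyXn.
have [->|Q0] := eqVneq Q 0; first by rewrite deriv0 mulr0 size_poly0.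
have s3 : (size (1 + 'X^2 : {poly R})%R <= 3)%N.
  by rewrite (leq_trans (size_polyD _ _)) // geq_max size_poly1 size_polyXn.
have := lt_size_deriv Q0; have := size_polyMleq (1 + 'X^2) Q^`(); lia.
Qed.

(* The induction step is the derivative of the identity in [c], multiplied by
   [1 + c ^ 2]. *)
Lemma cotD_duplication (R : realType) (k : nat) (c : R) : 0 < c ->
  (cotD R k).[c] + (cotD R k).[- c^-1] =
  2 ^+ k.+1 * (cotD R k).[(c - c^-1) / 2].
Proof.
elim: k c => [|k IHk] c c0; first by rewrite !hornerX expr1 mulrC divfK.
pose f := horner (cotD R k).
have c1 : c != 0 by rewrite gt_eqF.
have dV : is_derive c (1 : R) (fun y : R => y^-1) (- c ^- 2).
  apply: is_derive_eq (@is_deriveV R id c 1 1 c1 (is_derive_id _ _)) _.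
  by rewrite [_ *: _]mulr1.
have df (y : R) : is_derive y (1 : R) f (cotD R k)^`().[y] by exact: is_derive_poly.
have dN := is_deriveN dV.
have d1 := is_derive1_comp (df _) dN.
have d2 := is_derive1_comp (df _) (is_deriveZ 2^-1 (is_deriveB (is_derive_id c 1) dV)).
have d3 := is_deriveB (is_deriveD (df c) d1) (is_deriveZ (2 ^+ k.+1) d2).
have F0 : \forall y \near c, (f + (f \o - [eta GRing.inv]) -
    2 ^+ k.+1 \*: (f \o 2^-1 \*: (id - [eta GRing.inv]))) y = cst 0 y.
  near=> y.
  have y0 : 0 < y by near: y; exact: lt_nbhsr.
  change (f y + f (- y^-1) - 2 ^+ k.+1 * f (2^-1 * (y - y^-1)) = 0).
  by rewrite [2^-1 * _]mulrC -IHk // subrr.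
set q := (cotD R k)^`(); move: (near_eq_derive (1 : R) F0).
rewrite derive_cst derive_val -/q => /eqP; rewrite subr_eq0 => /eqP.
move=> e0; have {e0} : q.[c] + q.[- c^-1] * - - c ^- 2 =
  2 ^+ k.+1 * (q.[2^-1 * (c - c^-1)] * (2^-1 * (1 - - c ^- 2))) := e0.
rewrite [2^-1 * (c - c^-1)]mulrC => e.
rewrite !cotDS -/q !hornerM !hornerD !hornerXn -polyC1 !hornerC.
(* On the left, (1 + c^2) c^(-2) = 1 + (-1/c)^2. On the right, (1 + c^2)(1 + c^(-2))/2 is twice 1 +
   ((c - 1/c)/2)^2, which supplies the additional factor 2. *)
transitivity ((1 + c ^+ 2) * (q.[c] + q.[- c^-1] * - - c ^- 2)); first by field.
rewrite e [2 ^+ k.+2]exprS; move: (2 ^+ k.+1) q.[_] => u v; by field.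
Unshelve. all: by end_near. Qed.

Lemma cot_half (R : realType) (t : R) : 0 < t < pi ->
  [/\ 0 < cot (t / 2), cot (t / 2 + pi / 2) = - (cot (t / 2))^-1
    & cot t = (cot (t / 2) - (cot (t / 2))^-1) / 2].
Proof.
move=> /andP[t0 tpi].
have h : 0 < t / 2 < pi / 2 by rewrite divr_gt0 // ltr_pM2r // invr_gt0.
have s0 : 0 < sin (t / 2) by apply: sin_gt0_pihalf.
have c0 : 0 < cos (t / 2) by apply: cos_gt0_pihalf; lra.
rewrite /cot; split; first by rewrite divr_gt0.
  by rewrite cosDpihalf sinDpihalf invf_div mulNr.
have e : t = (t / 2) *+ 2 by rewrite -mulr_natr divfK.
rewrite [in LHS]e cos_mulr2n sin_mulr2n.
have := cos2Dsin2 (t / 2); move: (cos _) (sin _) s0 c0 => c s s0 c0 cs.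
rewrite -[X in _ - X]cs; field.
by rewrite !gt_eqF.
Qed.

Lemma cotD_distribution (R : realType) (k r : nat) (x : R) : 0 < x < 1 ->
  \sum_(0 <= j < 2 ^ r) (cotD R k).[cot (pi * ((x + j%:R) / 2 ^+ r))] =
  2 ^+ (r * k.+1) * (cotD R k).[cot (pi * x)].
Proof.
move=> /andP[x0 x1]; elim: r => [|r IHr].
  by rewrite big_nat1 addr0 divr1 mul1r.
rewrite mulSn exprD -mulrA -IHr expnS mul2n -addnn.
(* The points j and j + 2^r of level r+1 are y/2 and y/2 + 1/2 for the point y of level r, so each
   pair is a case of [cotD_duplication]. *)
rewrite (big_cat_nat (n := (2 ^ r)%N)) ?leq_addr //=.
pose G i := (cotD R k).[cot (pi * ((x + i%:R) / 2 ^+ r.+1))].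
rewrite -[X in _ + X]/(\sum_(0 + 2 ^ r <= i < 2 ^ r + 2 ^ r) G i).
rewrite big_addn addnK -big_split big_distrr /= {}/G.
apply: eq_big_nat => j /andP[_ jr].
set y := (x + j%:R) / 2 ^+ r.
have r0 : 0 < (2 : R) ^+ r by rewrite exprn_gt0.
have y0 : 0 < y by rewrite divr_gt0 // ltr_wpDr.
have y1 : y < 1.
  rewrite ltr_pdivrMr // mul1r (@lt_le_trans _ _ j.+1%:R) //.
    by rewrite -addn1 natrD addrC ltrD2l.
  by rewrite -natrX ler_nat.
have y01 : 0 < pi * y < pi by rewrite mulr_gt0 ?gtr_pMr ?pi_gt0.
have [h1 h2 h3] := cot_half y01.
have -> : pi * ((x + j%:R) / 2 ^+ r.+1) = pi * y / 2.
  by rewrite /y exprS; field; rewrite gt_eqF.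
have -> : pi * ((x + (j + 2 ^ r)%:R) / 2 ^+ r.+1) = pi * y / 2 + pi / 2.
  by rewrite /y natrD natrX exprS; field; rewrite gt_eqF.
by rewrite h2 h3 cotD_duplication.
Qed.

(** * Elementary bounds for the cotangent near 0 *)

Lemma ge0_of_is_derive (R : realType) (f df : R -> R) (b t : R) :
  (forall x : R, is_derive x (1 : R) f (df x)) -> f 0 = 0 ->
  (forall x, 0 < x < b -> 0 <= df x) -> 0 < t <= b -> 0 <= f t.
Proof.
move=> dfE f0 df0 /andP[t0 tb].
have cf : {within `[0, t], continuous f}%classic.
  apply: continuous_subspaceT => x; apply: differentiable_continuous.
  by apply/derivable1_diffP; have := dfE x; case.
have [x xt] := @MVT R f df 0 t t0 (fun x _ => dfE x) cf.
rewrite f0 !subr0 => ->; rewrite mulr_ge0 ?df0 ?ltW //.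
by move: xt; rewrite in_itv /= => /andP[-> /lt_le_trans ->].
Qed.

Lemma cot_bounds (R : realType) (t : R) : 0 < t <= pi / 2 ->
  [/\ 0 <= cot t, cot t <= t^-1 & t^-1 - cot t <= t].
Proof.
move=> tb; have /andP[t0 tpi] := tb.
have pi2 : pi / 2 < pi :> R by rewrite ltr_pdivrMr // ltr_pMr ?pi_gt0 // ltr1n.
have sinx_ge0 x : 0 < x < pi / 2 -> 0 <= sin x :> R.
  by move=> xb; rewrite ltW // sin_gt0_pihalf.
have cosx_ge0 x : 0 < x < pi / 2 -> 0 <= cos x :> R.
  by move=> xb; rewrite cos_ge0_pihalf //; lra.
have st : 0 < sin t by rewrite sin_gt0_pi // t0 (le_lt_trans tpi).
have ct : 0 <= cos t by rewrite cos_ge0_pihalf //; lra.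
have h1 : 0 <= t - sin t.
  apply: (@ge0_of_is_derive R (fun x => x - sin x) (fun x => 1 - cos x) (pi / 2)) => //.
  by rewrite sin0 subr0.
have h2 : 0 <= sin t - t * cos t.
  apply: (@ge0_of_is_derive R (fun x => sin x - x * cos x)
    (fun x => x * sin x) (pi / 2)) => //.
  - move=> x; apply: is_derive_eq (is_deriveB (is_derive_sin x)
      (is_deriveM (is_derive_id x 1) (is_derive_cos x))) _.
    change (cos x - (x * (- sin x) + cos x * 1) = x * sin x); ring.
  - by rewrite sin0 mul0r subr0.
  - by move=> x xb; rewrite mulr_ge0 ?sinx_ge0 //; lra.
have h3 : 0 <= t * sin t + cos t - 1.
  apply: (@ge0_of_is_derive R (fun x => x * sin x + cos x - 1)
    (fun x => x * cos x) (pi / 2)) => //.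
  - move=> x; apply: is_derive_eq.
    change (x * cos x + sin x * 1 + - sin x - 0 = x * cos x); ring.
  - by rewrite sin0 cos0 mul0r add0r subrr.
  - by move=> x xb; rewrite mulr_ge0 ?cosx_ge0 //; lra.
have tE : t^-1 - cot t = (sin t - t * cos t) / (t * sin t).
  by rewrite /cot; field; rewrite !gt_eqF.
split; first by rewrite divr_ge0 // ltW.
  by rewrite -subr_ge0 tE divr_ge0 // mulr_ge0 // ltW.
rewrite tE ler_pdivrMr ?mulr_gt0 //.
(* By [h1], sin t - t cos t <= t (1 - cos t), and [h3] bounds 1 - cos t by t sin t. *)
have : t * (1 - cos t) <= t * (t * sin t) by rewrite ler_pM2l //; lra.
by move: h1; nra.
Qed.

(** As 2M >= 1, all lower powers are dominated by (2M)^d. In the application M = 1/t with t <= pi/2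
    < 2. *)
Lemma horner_bound (R : realFieldType) (Q : {poly R}) (d : nat) :
  (size Q <= d.+1)%N -> exists2 C, 0 <= C &
  forall c M, 1 / 2 <= M -> `|c| <= M -> `|Q.[c]| <= C * M ^+ d.
Proof.
move=> sQ; exists (\sum_(i < size Q) `|Q`_i| * 2 ^+ d).
  by apply: sumr_ge0 => i _; rewrite mulr_ge0 ?exprn_ge0.
move=> c M M2 cM; rewrite horner_coef (le_trans (ler_norm_sum _ _ _)) //.
rewrite mulr_suml; apply: ler_sum => i _.
rewrite normrM normrX -mulrA ler_wpM2l // -exprMn.
have M1 : 1 <= 2 * M by lra.
apply: (@le_trans _ _ ((2 * M) ^+ i)).
  by apply: lerXn2r; rewrite ?nnegrE //; lra.
by rewrite ler_weXn2l // -ltnS (leq_trans (ltn_ord i)).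
Qed.

Lemma exprB_le (R : realFieldType) (n : nat) (c T : R) : 0 <= c <= T ->
  `|c ^+ n.+1 - T ^+ n.+1| <= n.+1%:R * T ^+ n * (T - c).
Proof.
move=> /andP[c0 cT]; have T0 := le_trans c0 cT.
rewrite distrC subrXX normrM ger0_norm ?subr_ge0 // mulrC ler_wpM2r ?subr_ge0 //.
rewrite (le_trans (ler_norm_sum _ _ _)) // mulr_natl -[X in _ *+ X]card_ord -sumr_const.
apply: ler_sum => i _; rewrite ger0_norm ?mulr_ge0 ?exprn_ge0 //.
rewrite (@le_trans _ _ (T ^+ (n.+1 - i.+1) * T ^+ i)) //.
  by rewrite ler_wpM2l ?exprn_ge0 // lerXn2r.
by rewrite -exprD subSS subnK // -ltnS.
Qed.

(** The remainder from [cotD_lead] has degree at most k. In the leading term, replacing cot t by 1/t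
    costs at most (k+2) t^(-k-1) (1/t - cot t), and the last factor is at most t. *)
Lemma cotD_near0 (R : realType) (k : nat) : exists2 C : R, 0 <= C &
  forall t, 0 < t <= pi / 2 ->
  `|(cotD R k.+1).[cot t] - (k.+1`!)%:R * t^-1 ^+ k.+2| <= C * t^-1 ^+ k.
Proof.
have [Q /horner_bound[C C0 QC] ->] := cotD_lead R k.+1.
exists (C + (k.+1`!)%:R * k.+2%:R) => [|t tb]; first by rewrite addr_ge0 // mulr_ge0.
have [c0 cT Tt] := cot_bounds tb; have /andP[t0 tpi] := tb.
have T0 : 0 < t^-1 by rewrite invr_gt0.
rewrite hornerD hornerZ hornerXn addrAC addrC -mulrBr.
rewrite (le_trans (ler_normD _ _)) // mulrDl lerD //.
  apply: QC; last by rewrite ger0_norm.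
  rewrite -[t^-1]div1r ler_pdivlMr //.
  by have := @pihalf_lt2 R; lra.
rewrite normrM ger0_norm // -mulrA ler_wpM2l //.
rewrite (le_trans (exprB_le _ _)) ?c0 // -mulrA ler_wpM2l // exprSr -mulrA.
by rewrite -[leRHS]mulr1 ler_wpM2l ?exprn_ge0 ?(ltW T0) // mulrC ler_pdivrMr // mul1r.
Qed.

(** * Sums over translates *)

(** For y <= 1/2 the principal part at 1 is harmless, since 1/(pi (1 - y)) <= 1. The other half
    follows by y -> 1 - y and the parity [cotDN]. *)
Lemma cotD_two_poles (R : realType) (k : nat) : exists2 C : R, 0 <= C &
  forall y, 0 < y < 1 ->
  `|(cotD R k.+1).[cot (pi * y)]
     - (k.+1`!)%:R * ((pi * y)^-1 ^+ k.+2 + (pi * (y - 1))^-1 ^+ k.+2)|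
  <= C * ((pi * y)^-1 ^+ k + (pi * (1 - y))^-1 ^+ k).
Proof.
have [C C0 hC] := cotD_near0 R k.
have pi0 := @pi_gt0 R; have pi1 := @pihalf_ge1 R.
have half y : 0 < y <= 1 / 2 ->
  `|(cotD R k.+1).[cot (pi * y)]
     - (k.+1`!)%:R * ((pi * y)^-1 ^+ k.+2 + (pi * (y - 1))^-1 ^+ k.+2)|
  <= (C + (k.+1`!)%:R) * ((pi * y)^-1 ^+ k + (pi * (1 - y))^-1 ^+ k).
  move=> /andP[y0 y1].
  have /hC hy : 0 < pi * y <= pi / 2 by rewrite mulr_gt0 //= ler_pM2l //; lra.
  have B0 : 0 <= (pi * (1 - y))^-1 by rewrite invr_ge0 mulr_ge0 //; lra.
  have B1 : (pi * (1 - y))^-1 <= 1.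
    rewrite invf_le1 ?mulr_gt0 //; last lra.
    by rewrite (le_trans pi1) // ler_pM2l //; lra.
  have A0 : 0 <= (pi * y)^-1 by rewrite invr_ge0 mulr_ge0 // ltW.
  have -> : pi * (y - 1) = - (pi * (1 - y)) by ring.
  rewrite invrN; move: (cotD _ _).[_] (pi * y)^-1 (pi * (1 - y))^-1 hy A0 B0 B1.
  move=> G A B hy A0 B0 B1.
  rewrite mulrDr opprD addrA (le_trans (ler_normB _ _)) //.
  rewrite (_ : (C + _) * _ = C * A ^+ k + (k.+1`!)%:R * B ^+ k
    + (C * B ^+ k + (k.+1`!)%:R * A ^+ k)); last by ring.
  rewrite ler_wpDr ?addr_ge0 ?mulr_ge0 ?exprn_ge0 // lerD //.
  rewrite normrM ger0_norm // ler_wpM2l // normrX normrN ger0_norm //.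
  by rewrite ler_wiXn2l // !leqW.
exists (C + (k.+1`!)%:R) => [|y /andP[y0 y1]]; first by rewrite addr_ge0.
have [yh|yh] := leP y (1 / 2); first by apply: half; rewrite y0.
have /half : 0 < 1 - y <= 1 / 2 by lra.
have -> : cot (pi * (1 - y)) = - cot (pi * y).
  by rewrite /cot mulrBr mulr1 addrC cosDpi sinDpi cosN sinN opprK mulNr.
have -> : 1 - (1 - y) = y by ring.
have -> : pi * (1 - y - 1) = - (pi * y) by ring.
have -> : pi * (y - 1) = - (pi * (1 - y)) by ring.
rewrite cotDN !invrN; move: (cotD _ _).[_] (pi * y)^-1 (pi * (1 - y))^-1 => G A B.
rewrite (exprNn A) (exprNn B) [X in _ <= _ * X]addrC => h.
have e1 : `|(-1) ^+ k.+2 : R| = 1 by rewrite normrX normrN1 expr1n.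
rewrite (le_trans _ h) // -[leLHS]mul1r -[X in X * `|_| <= _]e1 -normrM.
rewrite le_eqVlt; apply/orP; left; apply/eqP; congr `|_|.
have := sqrr_sign R k.+2; move: {e1 h} ((-1) ^+ _) (A ^+ _) (B ^+ _) => e a b e2.
have {2}-> : b = e ^+ 2 * b by rewrite e2 mul1r.
by ring.
Qed.

(** The sum of (x + j)^(-s) over -2^r <= j < 2^r, with j and j - 2^r paired: for y = (x + j)/2^r
    these are the scaled principal parts at 0 and at 1. *)
Definition poleSum (R : realType) (s r : nat) (x : R) : R :=
  \sum_(0 <= j < 2 ^ r) ((x + j%:R)^-1 ^+ s + (x + j%:R - 2 ^+ r)^-1 ^+ s).

(** After multiplication by 2^(r(k+2)), [cotD_distribution] applies. Each of the 2^r terms has an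
    error of order at most 2^(rk), so a factor 2^(-r) remains. *)
Lemma poleSum_near (R : realType) (k : nat) (x : R) : 0 < x < 1 ->
  exists C : R, forall r,
  `|(k.+1`!)%:R * (pi^-1 ^+ k.+2 * poleSum k.+2 r x) - (cotD R k.+1).[cot (pi * x)]|
    <= C * 2^-1 ^+ r.
Proof.
move=> /andP[x0 x1]; have [C C0 hC] := cotD_two_poles R k.
have pi0 := @pi_gt0 R.
have pi1 : 1 <= pi :> R by have := @pi_ge2 R; lra.
exists (C * (x^-1 ^+ k + (1 - x)^-1 ^+ k)) => r.
have r0 : 0 < (2 : R) ^+ r by rewrite exprn_gt0.
have rk0 : 0 < (2 : R) ^+ (r * k.+2) by rewrite exprn_gt0.
have x01 : 0 < x < 1 by rewrite x0.
rewrite -(ler_pM2l rk0) -[X in X * _ <= _](gtr0_norm rk0) -normrM mulrBr.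
rewrite -cotD_distribution //.
rewrite /poleSum !mulr_sumr -sumrB.
have jr j : (j < 2 ^ r)%N -> 0 < (x + j%:R) / 2 ^+ r < 1.
  move=> jr; rewrite divr_gt0 ?ltr_wpDr //= ltr_pdivrMr // mul1r.
  rewrite (@lt_le_trans _ _ j.+1%:R) //.
    by rewrite -addn1 natrD addrC ltrD2l.
  by rewrite -natrX ler_nat.
rewrite (le_trans (ler_norm_sum _ _ _)) //.
rewrite (@le_trans _ _ (\sum_(0 <= j < 2 ^ r)
   (2 ^+ (r * k) * (C * (x^-1 ^+ k + (1 - x)^-1 ^+ k))))) //; last first.
  rewrite sumr_const_nat subn0 -[leLHS]mulr_natr natrX [2^-1 ^+ r]exprVn.
  rewrite (_ : (r * k.+2 = r * k + r + r)%N); last lia.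
  rewrite !exprD le_eqVlt; apply/orP; left; apply/eqP.
  move: (2 ^+ r) (2 ^+ (r * k)) (_ + _) r0 => u v w u0; by field; rewrite gt_eqF.
have e (y : R) : 2 ^+ (r * k.+2) * ((k.+1`!)%:R * (pi^-1 ^+ k.+2 *
     ((2 ^+ r * y)^-1 ^+ k.+2 + (2 ^+ r * (y - 1))^-1 ^+ k.+2))) =
   (k.+1`!)%:R * ((pi * y)^-1 ^+ k.+2 + (pi * (y - 1))^-1 ^+ k.+2) :> R.
  rewrite exprM mulrCA; congr (_ * _); rewrite !invfM !exprMn -!mulrDr mulrCA.
  by congr (_ * _); rewrite mulrA -exprMn divff ?expr1n ?mul1r // gt_eqF.
rewrite !big_nat; apply: ler_sum => j /andP[_ j_lt]; have yj := jr _ j_lt.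
set y := (x + _) / _ in yj *.
have -> : x + j%:R = 2 ^+ r * y by rewrite /y mulrC divfK // gt_eqF.
have -> : 2 ^+ r * y - 2 ^+ r = 2 ^+ r * (y - 1) by ring.
have /andP[y0 y1] := yj.
rewrite e distrC (le_trans (hC _ yj)) // [leRHS]mulrCA ler_wpM2l // [leRHS]mulrDr exprM.
(* Used with a = x, b = y and with a = 1 - x, b = 1 - y, because 2^r y >= x and 2^r (1 - y) >= 1 -
   x. *)
have le_pow (a b : R) : 0 < a -> 0 < b -> a <= 2 ^+ r * (pi * b) ->
   (pi * b)^-1 ^+ k <= (2 ^+ r) ^+ k * a^-1 ^+ k.
  move=> a0 b0 ab; have pb : 0 < pi * b by rewrite mulr_gt0.
  rewrite -exprMn lerXn2r ?nnegrE ?divr_ge0 ?invr_ge0 ?(ltW a0) ?(ltW pb) ?(ltW r0) //.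
  by rewrite ler_pdivlMr // mulrC ler_pdivrMr.
have le_pi (b : R) : 0 < b -> b <= pi * b by move=> b0; rewrite ler_peMl // ltW.
apply: lerD; apply: le_pow => //; try lra.
  rewrite (le_trans _ (ler_wpM2l (ltW r0) (le_pi _ y0))) // /y mulrC divfK ?gt_eqF //.
  by rewrite lerDl.
have y10 : 0 < 1 - y by lra.
rewrite (le_trans _ (ler_wpM2l (ltW r0) (le_pi _ y10))) //.
rewrite mulrBr mulr1 /y [_ * (_ / _)]mulrC divfK ?gt_eqF //.
have : j.+1%:R <= (2 : R) ^+ r by rewrite -natrX ler_nat.
by rewrite -addn1 natrD; lra.
Qed.

Lemma cvg_poleSum (R : realType) (k : nat) (x : R) : 0 < x < 1 ->
  (poleSum k.+2 r x @[r --> \oo] -->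
     pi ^+ k.+2 / (k.+1`!)%:R * (cotD R k.+1).[cot (pi * x)])%classic.
Proof.
move=> /(poleSum_near k) [C hC]; set G := (cotD _ _).[_] in hC *.
have pi0 := @pi_gt0 R.
have f0 : 0 < (k.+1`!)%:R :> R by rewrite ltr0n fact_gt0.
have g0 : (C * 2^-1 ^+ r @[r --> \oo] --> (0 : R))%classic.
  by apply: cvg_geometric; rewrite ger0_norm ?invf_lt1 ?ltr1n.
have h : ((k.+1`!)%:R * (pi^-1 ^+ k.+2 * poleSum k.+2 r x) @[r --> \oo] --> G)%classic.
  apply: (@squeeze_cvgr _ _ _ _ (fun r => G - C * 2^-1 ^+ r)
    (fun r => G + C * 2^-1 ^+ r)).
  - by apply: nearW => r; have := hC r; rewrite ler_distl.
  - by rewrite -[X in (_ --> X)%classic]subr0; apply: cvgB => //; apply: cvg_cst.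
  - by rewrite -[X in (_ --> X)%classic]addr0; apply: cvgD => //; apply: cvg_cst.
have -> : poleSum k.+2 ^~ x = fun r => pi ^+ k.+2 / (k.+1`!)%:R *
    ((k.+1`!)%:R * (pi^-1 ^+ k.+2 * poleSum k.+2 r x)).
  apply/funext => r; have : pi ^+ k.+2 * pi^-1 ^+ k.+2 = 1 :> R.
    by rewrite -exprMn divff ?expr1n ?gt_eqF.
  move: f0; move: (_%:R) (pi ^+ _) (pi^-1 ^+ _) (poleSum _ _ _) => F a b z F0 ab.
  by rewrite -[LHS]mul1r -ab; field; rewrite gt_eqF.
by apply: cvgM => //; apply: cvg_cst.
Qed.

(** * Dirichlet series *)

Lemma sum_inv_sqr_le (R : realFieldType) (n : nat) :
  \sum_(0 <= k < n) (k.+1%:R : R)^-1 ^+ 2 <= 2.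
Proof.
(* Strengthened for induction: 1/(m+2)^2 <= 1/(m+1) - 1/(m+2). *)
suff h m : \sum_(0 <= k < m.+1) (k.+1%:R : R)^-1 ^+ 2 <= 2 - m.+1%:R^-1.
  case: n => [|n]; first by rewrite big_geq.
  by rewrite (le_trans (h n)) // gerBl invr_ge0.
elim: m => [|m IHm]; first by rewrite big_nat1 invr1 expr1n; lra.
rewrite big_nat_recr //= (@le_trans _ _ (2 - m.+1%:R^-1 + m.+2%:R^-1 ^+ 2)) //.
  by rewrite lerD2r.
have m0 : 0 < m.+1%:R :> R by [].
have vu : m.+2%:R^-1 <= m.+1%:R^-1 :> R by rewrite lef_pV2 ?posrE // ler_nat.
have e : m.+1%:R^-1 - m.+2%:R^-1 = m.+1%:R^-1 * m.+2%:R^-1 :> R.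
  by rewrite -[m.+2%:R]natr1; field; rewrite !gt_eqF // addr_gt0.
have v0 : 0 <= m.+2%:R^-1 :> R by rewrite invr_ge0.
move: (m.+1%:R^-1) (m.+2%:R^-1) vu e v0 => u v vu e v0.
by have := ler_wpM2r v0 vu; rewrite expr2; lra.
Qed.

Lemma cvg_inv_pow_class (R : realType) (N m k : nat) :
  cvgn (fun n => \sum_(0 <= j < n)
    ((j.+1 %% N)%N == m)%:R * (j.+1%:R : R)^-1 ^+ k.+2).
Proof.
have t0 (j : nat) : 0 <= ((j.+1 %% N)%N == m)%:R * (j.+1%:R : R)^-1 ^+ k.+2.
  by rewrite mulr_ge0 // exprn_ge0 // invr_ge0.
apply: nondecreasing_is_cvgn.
  by apply: nondecreasing_series => j _ _; exact: t0.
exists 2 => _ [n _ <-]; apply: le_trans (sum_inv_sqr_le R n).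
apply: ler_sum => j _; rewrite -[leRHS]mul1r ler_pM ?exprn_ge0 ?invr_ge0 //.
  by case: eqP.
by rewrite ler_wiXn2l ?invr_ge0 // invf_le1 ?ler1n.
Qed.

(** By periodicity the series is a finite combination of real series over residue classes, which
    converge by monotonicity. [f] transports them to the abstract field [K], whose topology is
    canonical. *)
Lemma Lpartial_cvgn (R : realType) (K : numFieldType) (f : {rmorphism R -> K})
    (N k : nat) (g : int -> K) :
  (forall (u : nat -> R) (l : R), (u n @[n --> \oo] --> l)%classic ->
     (f (u n) @[n --> \oo] --> f l)%classic) ->
  (0 < N)%N ->
  (forall m j : nat, g (m + j * N)%N = g m) -> cvgn (Lpartial g k.+2).
Proof.
move=> f_cvg N0 gN.
pose u m n := \sum_(0 <= j < n) ((j.+1 %% N)%N == m)%:R * (j.+1%:R : R)^-1 ^+ k.+2.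
have -> : Lpartial g k.+2 = fun n => \sum_(0 <= m < N) g m * f (u m n).
  apply/funext => n; rewrite /Lpartial seriesEnat /=.
  under [RHS]eq_bigr do rewrite /u rmorph_sum mulr_sumr.
  rewrite exchange_big; apply: eq_bigr => j _ /=.
  have jN : (j.+1 %% N < N)%N by rewrite ltn_mod.
  rewrite (bigD1_seq (j.+1 %% N)%N) ?mem_index_iota ?iota_uniq //= eqxx mul1r.
  rewrite big1 ?addr0 => [|m mj]; last first.
    by rewrite eq_sym (negbTE mj) mul0r rmorph0 mulr0.
  by rewrite rmorphXn fmorphV rmorph_nat exprVn {1}(divn_eq j.+1 N) addnC gN.
apply/cvg_ex; exists (\sum_(0 <= m < N) g m * f (limn (u m))).
apply: cvg_big => [|m _]; first exact: add_continuous.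
by apply: cvgM; [exact: cvg_cst | apply: f_cvg; exact: cvg_inv_pow_class].
Qed.

Lemma Lpartial_poleSum (R : realType) (K : numFieldType) (f : {rmorphism R -> K})
    (N s r : nat) (g : int -> K) : (0 < N)%N -> g 0 = 0 ->
  (forall m j : nat, g (m + j * N)%N = g m) ->
  (forall m : int, g (- m) = (-1) ^+ s * g m) ->
  (forall m j : nat, g ((j * N)%N%:Z - m%:Z) = g (- m%:Z)) ->
  2 * Lpartial g s (2 ^ r * N) =
    \sum_(1 <= m < N) g m * f (N%:R^-1 ^+ s * poleSum s r (m%:R / N%:R)).
Proof.
move=> N0 g0 gN gpar gN'; set M := (2 ^ r)%N.
pose h (k : nat) : K := g k * (k%:R^-1 ^+ s).
have gM : g (M * N)%N = 0 by rewrite -[(M * N)%N]add0n gN.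
have LE : Lpartial g s (M * N) = \sum_(0 <= k < M * N) h k.+1.
  by rewrite /Lpartial seriesEnat /=; apply: eq_bigr => k _; rewrite /h exprVn.
(* The range shifts by one because [g] vanishes at 0 and at M N. *)
have L1 : Lpartial g s (M * N) = \sum_(0 <= k < M * N) h k.
  rewrite LE; apply: (addrI (h 0%N)).
  rewrite -big_nat_recl // big_nat_recr //= /h gM g0 !mul0r add0r addr0 //.
(* Reflection k -> M N - k: the signs from the parity of [g] and from the power cancel. Adding [L1]
   and [L2] gives the two-sided sum. *)
have L2 : Lpartial g s (M * N) =
    \sum_(0 <= k < M * N) g k * (k%:R - (M * N)%:R)^-1 ^+ s.
  rewrite LE big_nat_rev /=; apply: eq_big_nat => k /andP[_ kM].
  rewrite add0n subnSK // /h -subzn ?(ltnW kM) // gN' gpar natrB ?(ltnW kM) //.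
  rewrite -[in RHS](opprB _ k%:R) [in RHS]invrN [in RHS]exprNn.
  by move: ((-1) ^+ s) ((_ - _)^-1 ^+ s) => e x; ring.
pose q (k : nat) : R := k%:R^-1 ^+ s + (k%:R - (M * N)%:R)^-1 ^+ s.
rewrite mulrDl mul1r {1}L1 L2 -big_split /=.
transitivity (\sum_(0 <= k < M * N) g k * f (q k)).
  apply: eq_bigr => k _; rewrite /h /q -mulrDr rmorphD !rmorphXn !fmorphV.
  by rewrite rmorphB !rmorph_nat.
rewrite big_nat_mul.
transitivity (\sum_(0 <= j < M) \sum_(0 <= m < N) g m * f (q (m + j * N)%N)).
  apply: eq_bigr => j _; rewrite -{1}[(j * N)%N]add0n big_addn mulSn addnK.
  by apply: eq_bigr => m _; rewrite gN.
rewrite exchange_big big_ltn //= big1 ?add0r => [|j _]; last by rewrite g0 mul0r.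
apply: eq_bigr => m _; rewrite -mulr_sumr -rmorph_sum; congr (_ * f _).
rewrite /poleSum mulr_sumr; apply: eq_bigr => j _.
have N1 : N%:R != 0 :> R by rewrite pnatr_eq0 -lt0n.
have -> : m%:R / N%:R + j%:R = (m + j * N)%:R / N%:R :> R.
  by rewrite natrD natrM; field.
have -> : (m + j * N)%:R / N%:R - 2 ^+ r = ((m + j * N)%:R - (M * N)%:R) / N%:R :> R.
  by rewrite [(M * N)%:R]natrM natrX; field.
by rewrite !invfM invrK mulrDr -!exprMn ![N%:R^-1 * _]mulrC !mulfK // divfK.
Qed.

Lemma Lseries_poleSum (R : realType) (K : numFieldType) (f : {rmorphism R -> K})
    (N k : nat) (g : int -> K) :
  (forall (u : nat -> R) (l : R), (u n @[n --> \oo] --> l)%classic ->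
     (f (u n) @[n --> \oo] --> f l)%classic) ->
  (0 < N)%N -> g 0 = 0 ->
  (forall m j : nat, g (m + j * N)%N = g m) ->
  (forall m : int, g (- m) = (-1) ^+ k * g m) ->
  (forall m j : nat, g ((j * N)%N%:Z - m%:Z) = g (- m%:Z)) ->
  cvgn (Lpartial g k.+2) /\
  2 * Lseries g k.+2 = \sum_(1 <= m < N)
    g m * f (N%:R^-1 ^+ k.+2 * (pi ^+ k.+2 / (k.+1`!)%:R *
      (cotD R k.+1).[cot (m%:R * pi / N%:R)])).
Proof.
move=> f_cvg N0 g0 gN gpar gN'.
have Lcvg : cvgn (Lpartial g k.+2) by exact: Lpartial_cvgn f_cvg N0 gN.
split=> //.
(* Since convergence is known, the limit may be computed along the indices 2^r N. *)
have lim1 : (2 * Lpartial g k.+2 (2 ^ r * N) @[r --> \oo]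
               --> 2 * Lseries g k.+2)%classic.
  apply: cvgM; first exact: cvg_cst.
  apply: (@cvg_comp _ _ _ (fun r => (2 ^ r * N)%N) (Lpartial g k.+2) _ _ _ _ Lcvg).
  apply/cvgnyPge => A; near=> r.
  apply: (@leq_trans r); first by near: r; exact: nbhs_infty_ge.
  by apply: (@leq_trans (2 ^ r)%N); [rewrite ltnW // ltn_expl | rewrite leq_pmulr].
have gpar2 (m : int) : g (- m) = (-1) ^+ k.+2 * g m.
  by rewrite gpar !exprS mulrA mulrNN mulr1 mul1r.
apply: (cvg_unique (@norm_hausdorff _ _) lim1).
change (2 * Lpartial g k.+2 (2 ^ r * N) @[r --> \oo] --> \sum_(1 <= m < N)
  g m * f (N%:R^-1 ^+ k.+2 * (pi ^+ k.+2 / (k.+1`!)%:R *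
    (cotD R k.+1).[cot (m%:R * pi / N%:R)])))%classic.
under eq_fun do rewrite (Lpartial_poleSum f) // big_nat.
rewrite big_nat.
apply: cvg_big => [|m /andP[m0 mN]]; first exact: add_continuous.
apply: cvgM; first exact: cvg_cst.
apply: f_cvg; apply: cvgM; first exact: cvg_cst.
have -> : m%:R * pi / N%:R = pi * (m%:R / N%:R) :> R by ring.
by apply: cvg_poleSum; rewrite divr_gt0 ?ltr0n //= ltr_pdivrMr ?ltr0n // mul1r ltr_nat.
Unshelve. all: by end_near. Qed.

(** * Specialization to complex Dirichlet characters *)

Lemma normc_real (R : realType) (x : R) : `|x%:C| = `|x|%:C.
Proof. by rewrite normc_def /= expr0n addr0 sqrtr_sqr. Qed.

Lemma cvg_real_complex (R : realType) (K : numFieldType := R[i])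
    (u : nat -> R) (l : R) :
  (u n @[n --> \oo] --> l)%classic ->
  (((u n)%:C : K) @[n --> \oo] --> (l%:C : K))%classic.
Proof.
move=> /cvgrPdist_le ul; apply/cvgrPdist_le => e e0.
(* A positive element of [R[i]] is real, so its real part serves as the real tolerance. *)
have [eI eR] : complex.Im e = 0 /\ 0 < complex.Re e.
  by move: e0; rewrite ltcE => /andP[/eqP].
apply: filterS (ul _ eR) => n uln.
rewrite -rmorphB normc_real lecE /= eI eqxx /=; exact: uln.
Qed.

Lemma dchar_addM (R : realType) (N : nat) (N1 : (1 < N)%N)
    (chi : dirichletChar R N) (m j : int) :
  dchar chi (m + j * N%:Z) = dchar chi m.
Proof.
rewrite /dchar /coprimez gcdzC addrC gcdzMDl gcdzC; case: ifP => // _.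
congr (chi (insubd _ _)).
by rewrite intrD intrM -[N%:~R]/(N%:R) (pchar_Zp N1) mulr0 add0r.
Qed.

Lemma unit_intr (N : nat) (N1 : (1 < N)%N) (m : int) :
  coprimez m N -> (m%:~R : 'Z_N) \is a GRing.unit.
Proof.
have unat (n : nat) : coprimez n N -> (n%:R : 'Z_N) \is a GRing.unit.
  by rewrite unitZpE // coprime_sym.
case: (intP m) => [|n|n].
- exact: unat 0%N.
- exact: unat n.+1.
- by rewrite coprimeNz rmorphN unitrN; exact: unat n.+1.
Qed.

Lemma dchar0 (R : realType) (N : nat) (N1 : (1 < N)%N) (chi : dirichletChar R N) :
  dchar chi 0 = 0.
Proof. by rewrite /dchar /coprimez gcd0z; case: eqP => // -[]; lia. Qed.

Lemma dcharN (R : realType) (N : nat) (N1 : (1 < N)%N) (chi : dirichletChar R N)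
    (m : int) :
  dchar chi (- m) = dchar chi (-1) * dchar chi m.
Proof.
rewrite /dchar !coprimeNz; case: ifP => [mN|_]; last by rewrite mulr0.
rewrite /coprimez gcd1z eqxx -dchar_mul; congr (dchar_unit _ _); apply: val_inj.
by rewrite /= !insubdK ?rmorphN ?mulN1r // ?unitrN ?unit_intr // /coprimez gcd1z.
Qed.
(** The condition on chi(-1) treats both parities at once: k is even for an even character and odd
    for an odd one. *)
Lemma Lseries_dchar (R : realType) (N k : nat) (chi : dirichletChar R N) :
  (1 < N)%N -> dchar chi (-1) = (-1) ^+ k ->
  cvgn (Lpartial (dchar chi) k.+2) /\
  Lseries (dchar chi) k.+2 =
    (pi ^+ k.+2 / (2 * (k.+1`!)%:R * N%:R ^+ k.+2) : R)%:C *
    \sum_(1 <= m < N) dchar chi m * ((cotD R k.+1).[cot (m%:R * pi / N%:R)])%:C.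
Proof.
move=> N1 chi1.
have := @Lseries_poleSum R R[i] (real_complex R) N k (dchar chi)
  (@cvg_real_complex R) (ltnW N1) (dchar0 N1 chi).
case.
- by move=> m j; rewrite -(dchar_addM N1 chi m j).
- by move=> m; rewrite dcharN // chi1.
- by move=> m j; rewrite -(dchar_addM N1 chi (- m%:Z) j) addrC.
move=> Lcvg L2; split=> //.
apply: (@mulfI _ (2 : R[i])); rewrite ?pnatr_eq0 // L2 !mulr_sumr.
apply: eq_bigr => m _.
have N0 : N%:R != 0 :> R by rewrite pnatr_eq0; lia.
have f0 : (k.+1`!)%:R != 0 :> R by rewrite pnatr_eq0 -lt0n fact_gt0.
have n0 : N%:R ^+ k.+2 != 0 :> R by rewrite expf_neq0.
rewrite exprVn; move: (dchar chi m) ((cotD _ _).[_]) => x c.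
move: (pi ^+ _) (N%:R ^+ _) ((k.+1`!)%:R) n0 f0 => p n F n0 F0.
have -> : n^-1 * (p / F * c) = 2 * (p / (2 * F * n)) * c by field; rewrite n0.
by rewrite !(rmorphM (real_complex R)) rmorph_nat; ring.
Qed.

(** * From cotangent polynomials to inverse powers of the sine *)

Lemma cycle_angle (R : realType) (N m : nat) : (0 < m < N)%N ->
  0 < (m%:R * pi / N%:R : R) < pi.
Proof.
move=> /andP[m0 mN]; have N0 : 0 < N%:R :> R by rewrite ltr0n; lia.
apply/andP; split; first by rewrite divr_gt0 // mulr_gt0 ?pi_gt0 ?ltr0n.
by rewrite ltr_pdivrMr // mulrC ltr_pM2l ?pi_gt0 ?ltr_nat.
Qed.

Lemma cot2D1 (R : realType) (t : R) : sin t != 0 -> 1 + cot t ^+ 2 = (sin t ^+ 2)^-1.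
Proof. by move=> s0; rewrite -[RHS]mul1r -[in RHS](cos2Dsin2 t) /cot; field. Qed.

Lemma cotD_sin_even (R : realType) (n : nat) (t : R) : sin t != 0 ->
  (cotD R (2 * n).+1).[cot t] =
  \sum_(1 <= i < n.+2) ratr (a_coef n.+1 i) / sin t ^+ (2 * i).
Proof.
move=> s0; rewrite (cotD_csc R n).1 horner_sum; apply: eq_bigr => i _.
rewrite hornerZ horner_exp hornerD hornerXn -polyC1 hornerC; congr (_ * _).
by rewrite cot2D1 // exprVn -exprM.
Qed.

Lemma cotD_sin_odd (R : realType) (n : nat) (t : R) : sin t != 0 ->
  (cotD R (2 * n).+2).[cot t] =
  2 * \sum_(1 <= i < n.+2) ratr (b_coef n.+1 i) * cot t / sin t ^+ (2 * i).
Proof.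
move=> s0; rewrite (cotD_csc R n).2 horner_sum mulr_sumr.
apply: eq_big_nat => i /andP[_ iN].
rewrite hornerZ hornerM hornerX horner_exp hornerD hornerXn -polyC1 hornerC.
have -> : ratr (b_coef n.+1 i) = i%:R * ratr (a_coef n.+1 i) :> R.
  by rewrite b_coef_a_coef // rmorphM /= ratr_nat.
rewrite cot2D1 //.
by rewrite exprVn -exprM !mulrA.
Qed.

Theorem theorem4p2 (R : realType) (N : nat) (hN : (2 <= N)%N) :
  [/\ (forall chi : dirichletChar R N, dchar_even chi ->
       forall n : nat, (1 <= n)%N ->
         cvgn (Lpartial (dchar chi) (2 * n)) /\
         Lseries (dchar chi) (2 * n) =
           (pi ^+ (2 * n) / (2 * ((2 * n - 1)`!)%:R * N%:R ^+ (2 * n)) : R)%:C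
           * \sum_(1 <= i < n.+1) ratr (a_coef n i) * cycleL i chi),
      (forall chi : dirichletChar R N, dchar_odd chi ->
       forall n : nat, (1 <= n)%N ->
         cvgn (Lpartial (dchar chi) (2 * n + 1)) /\
         Lseries (dchar chi) (2 * n + 1) =
           (pi ^+ (2 * n + 1) / (((2 * n)`!)%:R * N%:R ^+ (2 * n + 1)) : R)%:C
           * \sum_(1 <= i < n.+1) ratr (b_coef n i) * cycleLtilde i chi)
    & (forall n i : nat, (1 <= i <= n)%N ->
         b_coef n i = i%:R * a_coef n i)].
Proof.
have sinN0 m : (0 < m < N)%N -> sin (m%:R * pi / N%:R : R) != 0.
  by move=> mN; rewrite gt_eqF // sin_gt0_pi // cycle_angle.
have toCM (x y : R) : (x * y)%:C = x%:C * y%:C by exact: rmorphM.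
have toCV (x y : R) : (x / y)%:C = x%:C / y%:C by rewrite toCM fmorphV.
have N0 k : N%:R ^+ k != 0 :> R by rewrite expf_neq0 // pnatr_eq0; lia.
have F0 k : (k`!)%:R != 0 :> R by rewrite pnatr_eq0 -lt0n fact_gt0.
split=> [chi chi1 [//|n] _|chi chi1 [//|n] _|n i /andP[i0 iN]]; last first.
- by apply: b_coef_a_coef; lia.
- have -> : (2 * n.+1 + 1 = (2 * n).+3)%N by lia.
  have -> : (2 * n.+1 = (2 * n).+2)%N by lia.
  have chi2 : dchar chi (-1) = (-1) ^+ (2 * n).+1.
    by rewrite chi1 exprS exprM sqrrN expr1n expr1n mulr1.
  have [Lcvg ->] := Lseries_dchar hN chi2; split=> //.
  (* The 2 in 2 i a_(n,i) = 2 b_(n,i) cancels the 2 in the denominator of [Lseries_dchar]. *)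
  rewrite [X in _ * X = _](_ : _ = 2 *
      \sum_(1 <= i < n.+2) ratr (b_coef n.+1 i) * cycleLtilde i chi).
    rewrite mulrA; congr (_ * _); rewrite -(rmorph_nat (real_complex R) 2) -rmorphM /=.
    congr _%:C; move: (pi ^+ _) (N%:R ^+ _) (N0 (2 * n).+3) => p q q0.
    by move: (F0 (2 * n).+2) => F1; field; rewrite q0.
  rewrite mulr_sumr; under [RHS]eq_bigr do rewrite /cycleLtilde !mulr_sumr.
  rewrite exchange_big; apply: eq_big_nat => m mN /=.
  rewrite cotD_sin_odd ?sinN0 // rmorphM rmorph_nat rmorph_sum !mulr_sumr /=.
  by apply: eq_bigr => i _; rewrite toCV toCM (fmorph_rat (real_complex R)); ring.
- have -> : (2 * n.+1 = (2 * n).+2)%N by lia.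
  have chi2 : dchar chi (-1) = (-1) ^+ (2 * n).
    by rewrite chi1 exprM sqrrN expr1n expr1n.
  have [Lcvg ->] := Lseries_dchar hN chi2; split=> //.
  rewrite subn1; congr (_ * _).
  under [RHS]eq_bigr do rewrite /cycleL mulr_sumr.
  rewrite exchange_big; apply: eq_big_nat => m mN /=.
  rewrite cotD_sin_even ?sinN0 // rmorph_sum !mulr_sumr /=.
  by apply: eq_bigr => i _; rewrite toCV (fmorph_rat (real_complex R)); ring.
Qed.
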